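(* Let $d,n\ge1$ be integers, $P\in \mathrm{C}^0_+(\mathbb{T}^d)$ and $\mathcal{T}_d\in\mathfrak{S}^d_+$. The dual functional $$\mathbb{J}_P(\Lambda)=-\int_{\mathbb{T}^d}P(e^{i\boldsymbol\theta})\log\big(K^H(e^{i\boldsymbol\theta})\Lambda K(e^{i\boldsymbol\theta})\big)\,dm(\boldsymbol\theta)+\operatorname{tr}(\Lambda\mathcal{T}_d),\qquad \Lambda\in\mathfrak{L}^d_+,$$ is strictly convex.
   Context: $\mathbb{T}=(-\pi,\pi]$, $\boldsymbol\theta=(\theta_1,\dots,\theta_d)\in\mathbb{T}^d$, $e^{i\boldsymbol\theta}=(e^{i\theta_1},\dots,e^{i\theta_d})$, $dm(\boldsymbol\theta)=(1/2\pi)^d\prod_{j=1}^d d\theta_j$. $\mathrm{C}^0_+(\mathbb{T}^d)$ is the set of strictly positive continuous functions on the $d$-torus $\mathbb{T}^d$. $K(e^{i\theta_k})=[1,e^{i\theta_k},\dots,e^{in\theta_k}]^\top$ and $K(e^{i\boldsymbol\theta})=K(e^{i\theta_1})\otimes\cdots\otimes K(e^{i\theta_d})\in\mathbb{C}^{(n+1)^d}$ (Kronecker product); $M^H$ denotes conjugate transpose. $\Gamma_d:\Phi\mapsto\int_{\mathbb{T}^d}K(e^{i\boldsymbol\theta})\Phi(e^{i\boldsymbol\theta})K^H(e^{i\boldsymbol\theta})\,dm(\boldsymbol\theta)$, for $\Phi\in \mathrm{C}^0_+(\mathbb{T}^d)$. $\mathfrak{L}^d_+=\{\Lambda\in\operatorname{range}(\Gamma_d)\mid\Lambda\succ0\}$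 and $\mathfrak{S}^d_+=\{\mathcal{T}_d\in\operatorname{range}(\Gamma_d)\mid\mathcal{T}_d\succ0\}$, where $\succ0$ means Hermitian positive definite. *)

(* Defs.v *)
From HB Require Import structures.
From mathcomp Require Import all_boot all_order all_algebra.
From mathcomp Require Import all_classical all_reals all_analysis.
From mathcomp Require Import complex mxtens.

Set Implicit Arguments.
Unset Strict Implicit.
Unset Printing Implicit Defensive.

Import Order.TTheory GRing.Theory Num.Theory.
Import numFieldNormedType.Exports.

Local Open Scope classical_set_scope.
Local Open Scope ring_scope.
Local Open Scope complex_scope.
Local Open Scope sesquilinear_scope.

Section torus_measure.
Context (R : realType).

Definition T1 : set (measurableTypeR R) := `]- pi, pi].

Lemma measurable_T1 : measurable T1.
Proof. exact: measurable_itv. Qed.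

Lemma inv2pi_ge0 : 0 <= (2 * pi)^-1 :> R.
Proof. by rewrite invr_ge0 mulr_ge0// pi_ge0. Qed.

(* (2 pi)^-1 times the Lebesgue measure restricted to (-pi, pi] *)
Definition dm1 : set (measurableTypeR R) -> \bar R :=
  mscale (NngNum inv2pi_ge0) (mrestr lebesgue_measure measurable_T1).

HB.instance Definition _ := Measure.on dm1.

Lemma dm1_setT : dm1 setT = 1%E.
Proof.
rewrite /dm1 /mscale/= /mrestr setTI lebesgue_measure_itv/= lte_fin.
have pi0 := pi_gt0 R.
rewrite ifT; last by rewrite (lt_trans _ pi0)// oppr_lt0.
rewrite -EFinD -EFinM opprK -mulr2n -[pi *+ 2]mulr_natl mulVf//.
by rewrite mulf_neq0// gt_eqF.
Qed.

HB.instance Definition _ := Measure_isProbability.Build _ _ _ dm1 dm1_setT.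

Definition tcons k (x : measurableTypeR R * k.-tuple (measurableTypeR R)) :
  k.+1.-tuple (measurableTypeR R) := [tuple of x.1 :: x.2].

Lemma measurable_tcons k : measurable_fun setT (@tcons k).
Proof.
by apply: measurable_cons; [exact: measurable_fst|exact: measurable_snd].
Qed.

HB.instance Definition _ k :=
  isMeasurableFun.Build _ _ _ _ (@tcons k) (@measurable_tcons k).

(* The d-fold product of dm1, carried to d-tuples: distribution is the
   pushforward, here along the bijection (theta_1, rest) |-> theta_1 :: rest. *)
Fixpoint dm d : probability (d.-tuple (measurableTypeR R)) R :=
  if d is k.+1 then distribution (dm1 \x dm k)%E (@tcons k)
  else dirac [tuple].

Definition Td d : set (d.-tuple (measurableTypeR R)) :=
  [set theta | forall j, T1 (tnth theta j)].

End torus_measure.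

Arguments dm {R} d.
Arguments Td {R} d.

Section moment_map.
Context (R : realType).

(* The torus as a subset of C^d; R[i]^o is R[i] with its normed topology. *)
Definition torus d : set 'rV[R[i]^o]_d := [set z | forall j, `|z 0 j| = 1].

Definition expi d (theta : d.-tuple (measurableTypeR R)) : 'rV[R[i]^o]_d :=
  \row_j (cos (tnth theta j) +i* sin (tnth theta j)).

(* Functions on the torus are represented by total functions on C^d; their
   values off the torus are never used. *)
Definition C0plus d : set ('rV[R[i]^o]_d -> R) :=
  [set Phi : 'rV[R[i]^o]_d -> R |
     {within @torus d, continuous Phi} /\
     forall z, torus z -> 0 < Phi z].

Definition K1 n (z : R[i]) : 'cV[R[i]]_n.+1 := \col_(k < n.+1) z ^+ k.

(* K1 (z 0) (x) ... (x) K1 (z k); typechecks because a ^ k.+2 and a * a ^ k.+1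
   are convertible, which a ^ 1 and a * a ^ 0 are not. *)
Fixpoint K_rec n k : ('I_k.+1 -> R[i]) -> 'cV[R[i]]_(n.+1 ^ k.+1) :=
  if k is k'.+1 then fun z => K1 n (z ord0) *t K_rec n (z \o lift ord0)
  else fun z => K1 n (z ord0).

Definition K n d : 'rV[R[i]^o]_d -> 'cV[R[i]]_(n.+1 ^ d) :=
  if d is k.+1 then fun z => K_rec n (z 0) else fun=> 1%:M.

Definition cintegral d (f : d.-tuple (measurableTypeR R) -> R[i]) : R[i] :=
  (\int[dm d]_(theta in Td d) complex.Re (f theta))%R +i*
  (\int[dm d]_(theta in Td d) complex.Im (f theta))%R.

Definition Gamma n d (Phi : 'rV[R[i]^o]_d -> R) : 'M[R[i]]_(n.+1 ^ d) :=
  \matrix_(a, b) cintegral (fun theta =>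
    (K n (expi theta) *m (Phi (expi theta))%:C%:M *m (K n (expi theta)) ^t*) a b).

(* Gamma has domain C0plus. *)
Definition range_Gamma n d : set 'M[R[i]]_(n.+1 ^ d) :=
  @Gamma n d @` @C0plus d.

(* The order of R[i] makes 0 < z mean that z is real and positive. *)
Definition posdef N (A : 'M[R[i]]_N) : Prop :=
  A ^t* = A /\ forall v : 'cV_N, v != 0 -> 0 < (v ^t* *m A *m v) 0 0.

Definition Lplus n d : set 'M[R[i]]_(n.+1 ^ d) :=
  [set L | range_Gamma L /\ posdef L].

Definition Splus n d : set 'M[R[i]]_(n.+1 ^ d) :=
  [set T | range_Gamma T /\ posdef T].

(* For L and T Hermitian, both arguments of Re are real. *)
Definition J n d (P : 'rV[R[i]^o]_d -> R) (T L : 'M[R[i]]_(n.+1 ^ d)) : R :=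
  - (\int[dm d]_(theta in Td d)
       (P (expi theta) *
        ln (complex.Re (((K n (expi theta)) ^t* *m L *m K n (expi theta)) 0 0))))%R
  + complex.Re (\tr (L *m T)).

(* Strict convexity on D, including the convexity of D itself. *)
Definition strictly_convex_on N (D : set 'M[R[i]]_N) (f : 'M[R[i]]_N -> R) :=
  (forall A B (t : R), D A -> D B -> 0 <= t <= 1 ->
     D (t%:C *: A + (1 - t)%:C *: B)) /\
  (forall A B (t : R), D A -> D B -> A <> B -> 0 < t < 1 ->
     f (t%:C *: A + (1 - t)%:C *: B) < t * f A + (1 - t) * f B).

End moment_map.

(* Main.v *)
Require Import Defs.
From mathcomp Require Import all_boot all_order all_algebra.
From mathcomp Require Import all_classical all_reals all_analysis.
From mathcomp Require Import complex mxtens.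
From mathcomp Require Import measurable_realfun ring lra.

Set Implicit Arguments.
Unset Strict Implicit.
Unset Printing Implicit Defensive.

Import Order.TTheory GRing.Theory Num.Theory.
Import numFieldNormedType.Exports.

Local Open Scope classical_set_scope.
Local Open Scope ring_scope.
Local Open Scope complex_scope.
Local Open Scope sesquilinear_scope.

(** Write [q_L(theta)] for the Hermitian form of [L] at the vector [K]; it is
    positive everywhere on the torus when [L] is positive definite, because
    [K] never vanishes ([K_neq0]).  The map from [L] to [q_L(theta)] and the
    trace term are both linear, so along a segment from [A] to [B] the
    convexity defect of the functional is the integral of
      [P * (ln q_M - s * ln q_A - (1 - s) * ln q_B)],   [M = s A + (1 - s) B],
    which is nonnegative by concavity of the logarithm.  It vanishes only if
    [q_A = q_B] almost everywhere ([ln_strictly_concave],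
    [Rintegral_eq0_ae]).

    What makes the convexity strict is that a matrix in the range of [Gamma]
    is determined by its form ([Lplus_eq]).  Indeed
      [tr (L Gamma(Phi)) = integral of Phi * q_L]   ([mxtrace_mul_Gamma]),
    so if [D = A - B = Gamma(Phi) - Gamma(Psi)] has [q_D = 0] almost
    everywhere, then [tr (D D) = 0].  As [D] is Hermitian, this is the sum of
    the squared moduli of its entries, and [D = 0].

    The domain is convex because [Gamma] is linear and convex combinations of
    positive continuous functions are positive and continuous.

    Linearity of the integrals requires integrability.  Every integrand is
    continuous in the angles, and a continuous function of the angles is
    bounded on the compact cube and measurable for the product sigma-algebra
    of tuples ([acontinuous_integrable]). *)

(** * Continuous functions of the angles *)

Section continuous_on_tuples.
Context (R : realType) (d : nat).
Local Notation angles := (d.-tuple (measurableTypeR R)).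

Definition angles_of_row (x : 'rV[R]_d) : angles := [tuple x 0 j | j < d].

Definition row_of_angles (t : angles) : 'rV[R]_d := \row_j tnth t j.

Lemma row_of_anglesK : cancel row_of_angles angles_of_row.
Proof. by move=> t; apply: eq_from_tnth => j; rewrite tnth_mktuple mxE. Qed.

(** Tuples carry a sigma-algebra but no topology, so continuity is read on row
    vectors. *)
Definition acontinuous (f : angles -> R) : Prop :=
  continuous (f \o angles_of_row).

(** Boxes with rational corners form a countable base, which is what relates
    the topology of row vectors to the sigma-algebra of tuples. *)
Lemma nbhs_row_rat_box (A : set 'rV[R]_d) (x : 'rV[R]_d) : nbhs x A ->
  exists p : d.-tuple rat * d.-tuple rat,
    (forall j, ratr (tnth p.1 j) < x 0 j < ratr (tnth p.2 j)) /\
    (forall y : 'rV[R]_d,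
       (forall j, ratr (tnth p.1 j) < y 0 j < ratr (tnth p.2 j)) -> A y).
Proof.
move=> [Q xQ QA].
have /choice[e eP] j : exists e : R, 0 < e /\ ball (x 0 j) e `<=` Q 0 j.
  by have /nbhs_ballP[e e0 eQ] := xQ 0 j; exists e.
have /choice[a aP] j : exists a : rat, x 0 j - e j < ratr a < x 0 j.
  have /rat_in_itvoo[q] : x 0 j - e j < x 0 j by rewrite gtrBl; have [] := eP j.
  by rewrite in_itv /=; exists q.
have /choice[b bP] j : exists b : rat, x 0 j < ratr b < x 0 j + e j.
  have /rat_in_itvoo[q] : x 0 j < x 0 j + e j by rewrite ltrDl; have [] := eP j.
  by rewrite in_itv /=; exists q.
exists ([tuple a j | j < d], [tuple b j | j < d]); split => [j|y yab].
  rewrite !tnth_mktuple.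
  by have /andP[_ ->] := aP j; have /andP[-> _] := bP j.
apply: QA => i j; rewrite ord1; have [_] := eP j; apply.
have := yab j; rewrite !tnth_mktuple /ball /= => /andP[ay yb].
have /andP[xa ax] := aP j; have /andP[xb bx] := bP j.
by rewrite distrC ltr_distl; apply/andP; split; lra.
Qed.

Lemma open_measurable_angles (A : set 'rV[R]_d) : open A ->
  measurable (row_of_angles @^-1` A).
Proof.
move=> Aopen.
pose box (p : d.-tuple rat * d.-tuple rat) : set angles :=
  \bigcap_(j in [set: 'I_d])
    ((@tnth d _)^~ j @^-1` `]ratr (tnth p.1 j), ratr (tnth p.2 j)[%classic).
have boxE p t : box p t <-> forall j,
    ratr (tnth p.1 j) < row_of_angles t 0 j < ratr (tnth p.2 j).
  by split => [bt j|bt j _]; [have := bt j I|have := bt j];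
    rewrite mxE /= in_itv.
have boxm p : measurable (box p).
  apply: fin_bigcap_measurable => // j _.
  by rewrite -[X in measurable X]setTI; apply: measurable_tnth.
pose inside p := forall y : 'rV[R]_d,
    (forall j, ratr (tnth p.1 j) < y 0 j < ratr (tnth p.2 j)) -> A y.
rewrite (_ : _ @^-1` _ =
  \bigcup_(p : d.-tuple rat * d.-tuple rat)
    (if `[< inside p >] then box p else set0)).
  apply: countable_bigcupT_measurable => [|p]; first exact: countableP.
  by case: ifP.
apply/seteqP; split => [t At|t [p _]].
  have [p [tp pA]] := nbhs_row_rat_box (open_nbhs_nbhs (conj Aopen At)).
  by exists p => //; rewrite (asboolT pA); apply/boxE.
by case: ifP => // /asboolP pA /boxE /pA.
Qed.

Lemma acontinuous_measurable (f : angles -> R) : acontinuous f ->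
  measurable_fun setT f.
Proof.
move=> cf; apply: (measurability _ (RGenOpens.measurableE R)).
move=> _ [_ [a [b ->] <-]]; rewrite setTI.
have oab : open `]a, b[%classic by exact: interval_open.
have := open_measurable_angles (open_comp (fun x _ => cf x) oab).
congr measurable; apply/seteqP.
by split => t /=; rewrite row_of_anglesK.
Qed.

Lemma measurable_Td : measurable (@Td R d).
Proof.
rewrite (_ : Td d = \bigcap_(j in [set: 'I_d]) ((@tnth d _)^~ j @^-1` @T1 R)).
  apply: fin_bigcap_measurable => // j _.
  rewrite -[X in measurable X]setTI; apply: measurable_tnth => //.
  exact: measurable_T1.
by apply/seteqP; split => t tT j; [move=> _|]; apply: tT.
Qed.

(** The half-open cube [Td d] is contained in a compact closed cube. *)
Lemma acontinuous_bounded (f : angles -> R) : acontinuous f ->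
  exists M : R, forall t, Td d t -> `|f t| <= M.
Proof.
move=> cf.
pose cube :=
  [set v : 'rV[R]_d | forall j, `[- pi, pi]%classic (v ord0 j)].
have : compact ((f \o angles_of_row) @` cube).
  apply: continuous_compact; first exact: continuous_subspaceT.
  by apply: (@rV_compact _ d (fun=> `[- pi, pi]%classic)) => _;
    exact: segment_compact.
move=> /compact_bounded[M [_ MP]]; exists (M + 1) => t tT.
apply: (MP (M + 1)); first by rewrite ltrDl.
exists (row_of_angles t); last by rewrite /= row_of_anglesK.
move=> j; rewrite mxE /=; have := tT j; rewrite /T1 /= !in_itv /=.
by move=> /andP[/ltW -> ->].
Qed.

Lemma acontinuous_integrable (f : angles -> R) : acontinuous f ->
  (dm d).-integrable (Td d) (EFin \o f).
Proof.
move=> cf; apply: measurable_bounded_integrable.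
- exact: measurable_Td.
- by apply: (le_lt_trans (probability_le1 _ measurable_Td)); exact: ltry.
- by apply: measurable_funTS; apply: acontinuous_measurable.
have [M Mf] := acontinuous_bounded cf.
exists M; split; first exact: num_real.
by move=> y My t tT; apply: le_trans (ltW My); apply: Mf.
Qed.

End continuous_on_tuples.

(** * Continuity of the integrands *)

Section continuity_rules.
Context (R : realType) (d : nat).
Local Notation angles := (d.-tuple (measurableTypeR R)).
Implicit Types (f g : angles -> R) (u v : angles -> R[i]).

Lemma acontinuous_cst (c : R) : acontinuous (fun _ : angles => c).
Proof. exact: (@cst_continuous 'rV[R]_d R c). Qed.

Lemma acontinuous_tnth j : acontinuous (fun t : angles => tnth t j).
Proof.
rewrite /acontinuous (_ : _ \o _ = fun x : 'rV[R]_d => x 0 j).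
  exact: coord_continuous.
by apply/funext => x /=; rewrite tnth_mktuple.
Qed.

Lemma acontinuousD f g : acontinuous f -> acontinuous g ->
  acontinuous (fun t => f t + g t).
Proof. by move=> cf cg x; exact: cvgD (cf x) (cg x). Qed.

Lemma acontinuousN f : acontinuous f -> acontinuous (fun t => - f t).
Proof. by move=> cf x; exact: cvgN (cf x). Qed.

Lemma acontinuousM f g : acontinuous f -> acontinuous g ->
  acontinuous (fun t => f t * g t).
Proof. by move=> cf cg x; exact: cvgM (cf x) (cg x). Qed.

Lemma acontinuous_comp (h : R -> R) f : (forall t, {for f t, continuous h}) ->
  acontinuous f -> acontinuous (fun t => h (f t)).
Proof.
move=> ch cf x.
apply: (@continuous_comp _ _ _ (f \o @angles_of_row R d) h); first exact: cf.
exact: ch.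
Qed.

(** Real and imaginary parts are treated separately because [cintegral]
    integrates them separately. *)
Definition ccontinuous u : Prop :=
  acontinuous (fun t => complex.Re (u t)) /\
  acontinuous (fun t => complex.Im (u t)).

Lemma ccontinuous_cst (c : R[i]) : ccontinuous (fun=> c).
Proof. by split; exact: acontinuous_cst. Qed.

Lemma ccontinuous_real f : acontinuous f -> ccontinuous (fun t => (f t)%:C).
Proof. by move=> cf; split => //=; exact: acontinuous_cst. Qed.

Lemma ccontinuousD u v : ccontinuous u -> ccontinuous v ->
  ccontinuous (fun t => u t + v t).
Proof.
move=> [ur ui] [vr vi]; split.
- rewrite (_ : (fun t => _) = fun t => complex.Re (u t) + complex.Re (v t)).
    exact: acontinuousD.
  by apply/funext => t; rewrite raddfD.
- rewrite (_ : (fun t => _) = fun t => complex.Im (u t) + complex.Im (v t)).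
    exact: acontinuousD.
  by apply/funext => t; rewrite raddfD.
Qed.

Lemma ReD (x y : R[i]) : complex.Re (x + y) = complex.Re x + complex.Re y.
Proof. by case: x; case: y. Qed.

Lemma ReM (x y : R[i]) : complex.Re (x * y) =
  complex.Re x * complex.Re y - complex.Im x * complex.Im y.
Proof. by case: x; case: y. Qed.

Lemma ImM (x y : R[i]) : complex.Im (x * y) =
  complex.Re x * complex.Im y + complex.Im x * complex.Re y.
Proof. by case: x; case: y. Qed.

Lemma Re_realM (c : R) (z : R[i]) : complex.Re (c%:C * z) = c * complex.Re z.
Proof. by rewrite ReM /= mul0r subr0. Qed.

Lemma ccontinuousM u v : ccontinuous u -> ccontinuous v ->
  ccontinuous (fun t => u t * v t).
Proof.
move=> [ur ui] [vr vi]; split.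
- under eq_fun do rewrite ReM.
  by apply: acontinuousD; [|apply: acontinuousN]; exact: acontinuousM.
- under eq_fun do rewrite ImM.
  by apply: acontinuousD; exact: acontinuousM.
Qed.

Lemma ccontinuousX u k : ccontinuous u -> ccontinuous (fun t => u t ^+ k).
Proof.
move=> cu; elim: k => [|k IH]; first exact: ccontinuous_cst.
by under eq_fun do rewrite exprS; exact: ccontinuousM.
Qed.

Lemma ccontinuousJ u : ccontinuous u -> ccontinuous (fun t => Num.conj (u t)).
Proof.
move=> [ur ui]; split.
- by rewrite (_ : (fun t => _) = (fun t => complex.Re (u t))) //;
    apply/funext => t; case: (u t).
- rewrite (_ : (fun t => _) = (fun t => - complex.Im (u t))).
    exact: acontinuousN.
  by apply/funext => t; case: (u t).
Qed.

Lemma ccontinuous_sum (I : Type) (s : seq I) (F : I -> angles -> R[i]) :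
  (forall i, ccontinuous (F i)) -> ccontinuous (fun t => \sum_(i <- s) F i t).
Proof.
move=> cF; elim: s => [|i s IH].
  by under eq_fun do rewrite big_nil; exact: ccontinuous_cst.
by under eq_fun do rewrite big_cons; exact: ccontinuousD.
Qed.

Lemma ccontinuous_expi j : ccontinuous (fun t : angles => expi t 0 j).
Proof.
split; under eq_fun do rewrite mxE /=.
- apply: acontinuous_comp; last exact: acontinuous_tnth.
  by move=> t; exact: continuous_cos.
- apply: acontinuous_comp; last exact: acontinuous_tnth.
  by move=> t; exact: continuous_sin.
Qed.

Lemma torus_expi (t : angles) : torus (expi t).
Proof. by move=> j; rewrite mxE normc_def /= cos2Dsin2 sqrtr1. Qed.

Lemma normc_lt (z : R[i]) (e : R) : 0 < e -> `|complex.Re z| < e / 2 ->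
  `|complex.Im z| < e / 2 -> `|z| < e%:C.
Proof.
move=> e0; rewrite !ltr_norml => /andP[a1 a2] /andP[b1 b2].
rewrite normc_def ltcR -[ltRHS]ger0_norm ?(ltW e0)// -sqrtr_sqr.
by rewrite ltr_sqrt ?exprn_gt0//; nra.
Qed.

(** [Phi] is continuous only along the torus, in the topology of [R[i]^o] whose
    radii are complex numbers; the map [expi] stays in the torus, and a
    positive complex radius is a positive real one, so both obstacles vanish
    after composition. *)
Lemma acontinuous_torus (Phi : 'rV[R[i]^o]_d -> R) :
  {within @torus R d, continuous Phi} -> acontinuous (fun t => Phi (expi t)).
Proof.
move=> /subspace_continuousP cPhi x A /(cPhi _ (torus_expi _)).
move=> [Q xQ QA].
have near_coord j : \forall y \near x, Q 0 j (expi (angles_of_row y) 0 j).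
  have /nbhs_ballP[e e0 eQ] := xQ 0 j.
  have [/= r0 i0] : 0 < complex.Re e /\ complex.Im e = 0.
    by move: e0; rewrite /= ltcE /= => /andP[/eqP -> ->].
  have eE : e = (complex.Re e)%:C by case: (e) i0 => a b /= ->.
  have [cRe cIm] := @ccontinuous_expi j.
  have e2 : 0 < complex.Re e / 2 by rewrite divr_gt0.
  have /cvgrPdist_lt/(_ _ e2) /= nRe := cRe x.
  have /cvgrPdist_lt/(_ _ e2) /= nIm := cIm x.
  near=> y; apply: eQ; rewrite -ball_normE /= eE; apply: normc_lt => //.
  - by rewrite raddfB; near: y.
  - by rewrite raddfB; near: y.
have : \forall y \near x, forall j, Q 0 j (expi (angles_of_row y) 0 j).
  exact: (@filter_forall _ _
    (fun j => [set y : 'rV[R]_d | Q 0 j (expi (angles_of_row y) 0 j)])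
    (nbhs x)).
apply: filterS => y Qy.
by apply: QA; [move=> i j; rewrite ord1; exact: Qy|exact: torus_expi].
Unshelve. all: by end_near.
Qed.

Lemma ccontinuous_K_rec n k (z : angles -> 'I_k.+1 -> R[i]) a :
  (forall j, ccontinuous (fun t => z t j)) ->
  ccontinuous (fun t => K_rec n (z t) a 0).
Proof.
elim: k => [|k IH] in z a *; move=> cz.
  by under eq_fun do rewrite /= mxE; exact: ccontinuousX.
under eq_fun do rewrite /= mxE mxE (ord1 (mxtens_unindex _).2).
apply: ccontinuousM; first exact: ccontinuousX.
by apply: IH => j; exact: cz.
Qed.

End continuity_rules.

Lemma ccontinuous_K (R : realType) n d a :
  ccontinuous (fun t : d.-tuple (measurableTypeR R) => K n (expi t) a 0).
Proof.
case: d a => [|k] a; first exact: ccontinuous_cst.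
apply: (@ccontinuous_K_rec R k.+1 n k (fun t j => expi t 0 j)) => j.
exact: ccontinuous_expi.
Qed.

(** The entry of multi-index zero is a product of zeroth powers. *)
Lemma K_rec_neq0 (R : realType) n k (z : 'I_k.+1 -> R[i]) :
  exists a, K_rec n z a 0 != 0.
Proof.
elim: k => [|k IH] in z *; first by exists ord0; rewrite mxE expr0 oner_eq0.
have [a a_neq0] := IH (z \o lift ord0).
exists (mxtens_index (ord0, a)).
rewrite /= mxE mxtens_indexK /= mxE expr0 mul1r.
by rewrite [X in K_rec _ _ _ X](_ : _ = 0) //; apply: ord1.
Qed.

Lemma K_neq0 (R : realType) n d (z : 'rV[R[i]^o]_d) : K n z != 0.
Proof.
suff [a a_neq0] : exists a, K n z a 0 != 0.
  by apply: contraNneq a_neq0 => ->; rewrite mxE.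
case: d z => [|k] z; last exact: K_rec_neq0.
by exists 0; rewrite mxE eqxx oner_eq0.
Qed.

(** * Integration over the torus *)

Section complex_integral.
Context (R : realType) (d : nat).
Local Notation angles := (d.-tuple (measurableTypeR R)).
Implicit Types (u v : angles -> R[i]).

Lemma cintegralD u v : ccontinuous u -> ccontinuous v ->
  cintegral (fun t => u t + v t) = cintegral u + cintegral v.
Proof.
move=> [ur ui] [vr vi]; rewrite /cintegral.
under eq_Rintegral do rewrite raddfD.
under [X in _ +i* X]eq_Rintegral do rewrite raddfD.
by rewrite !RintegralD //;
  solve [exact: measurable_Td|exact: acontinuous_integrable].
Qed.

Lemma cintegralZ (c : R[i]) u : ccontinuous u ->
  cintegral (fun t => c * u t) = c * cintegral u.
Proof.
move=> [ur ui]; have mT := @measurable_Td R d.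
have ir := acontinuous_integrable ur; have ii := acontinuous_integrable ui.
have irc a := acontinuous_integrable (acontinuousM (@acontinuous_cst R d a) ur).
have iic a := acontinuous_integrable (acontinuousM (@acontinuous_cst R d a) ui).
rewrite /cintegral.
under eq_Rintegral do rewrite ReM.
under [X in _ +i* X]eq_Rintegral do rewrite ImM.
by rewrite RintegralB // RintegralD // !RintegralZl //; case: c.
Qed.

Lemma cintegral0 : cintegral (fun _ : angles => 0) = 0.
Proof.
by rewrite /cintegral /= !Rintegral_cst ?mul0r //; exact: measurable_Td.
Qed.

Lemma cintegral_sum (I : Type) (s : seq I) (F : I -> angles -> R[i]) :
  (forall i, ccontinuous (F i)) ->
  cintegral (fun t => \sum_(i <- s) F i t) = \sum_(i <- s) cintegral (F i).
Proof.
move=> cF; elim: s => [|i s IH].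
  rewrite big_nil -[RHS]cintegral0; congr cintegral.
  by apply/funext => t; rewrite big_nil.
rewrite big_cons -IH -cintegralD //; last exact: ccontinuous_sum.
by congr cintegral; apply/funext => t; rewrite big_cons.
Qed.

Lemma Rintegral_ae0 (f : angles -> R) : acontinuous f ->
  {ae dm d, forall t, Td d t -> f t = 0} -> \int[dm d]_(t in Td d) f t = 0.
Proof.
move=> cf f0; rewrite /Rintegral (ae_eq_integral (cst 0%E)) //.
- by rewrite integral_cst ?mul0e //; exact: measurable_Td.
- exact: measurable_Td.
- exact: measurable_int (acontinuous_integrable cf).
- by apply: filterS f0 => t f0 /f0 /= ->.
Qed.

Lemma cintegral_ae0 u : ccontinuous u ->
  {ae dm d, forall t, Td d t -> u t = 0} -> cintegral u = 0.
Proof.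
move=> [ur ui] u0; rewrite /cintegral !Rintegral_ae0 //.
- by apply: filterS u0 => t u0 /u0 ->.
- by apply: filterS u0 => t u0 /u0 ->.
Qed.

Lemma Rintegral_eq0_ae (f : angles -> R) : acontinuous f ->
  (forall t, Td d t -> 0 <= f t) -> \int[dm d]_(t in Td d) f t = 0 ->
  {ae dm d, forall t, Td d t -> f t = 0}.
Proof.
move=> cf f_ge0 int0; have f_int := acontinuous_integrable cf.
have mT := @measurable_Td R d.
have : (\int[dm d]_(t in Td d) `|(f t)%:E| = 0)%E.
  rewrite (eq_integral (EFin \o f)) => [|t /set_mem /f_ge0 ft]; last first.
    by rewrite gee0_abs ?lee_fin.
  by rewrite -(fineK (integrable_fin_num mT f_int)); congr (_%:E).
move=> /(ae_eq_integral_abs _ mT (measurable_int _ f_int)).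
by apply: filterS => t f0 /f0 [].
Qed.

End complex_integral.

(** * Strict concavity of the logarithm *)

(** The tangent inequality [ln x <= x - 1] at [x = a / b], strict unless
    [x = 1]. *)
Lemma ln_tangent_leif (R : realType) (a b : R) : 0 < a -> 0 < b ->
  ln a - ln b <= a / b - 1 ?= iff (a == b).
Proof.
move=> a0 b0; have ab0 : 0 < a / b by rewrite divr_gt0.
rewrite -ln_div ?posrE //; split.
  by rewrite lerBrDl -[leRHS]lnK ?posrE // expR_ge1Dx.
apply/eqP/eqP => [lnab|->]; last by rewrite divff ?gt_eqF // ln1 subrr.
have : ln (a / b) = 0.
  apply/eqP/negPn/negP => /expR_gt1Dx.
  by rewrite lnK ?posrE // lnab addrC subrK ltxx.
move/eqP; rewrite ln_eq0 // => /eqP ab1.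
by rewrite -[a](divfK (lt0r_neq0 b0)) ab1 mul1r.
Qed.

(** Average the tangent inequalities of [a] and [b] at their barycentre [m]:
    the right-hand sides cancel, and equality forces equality in both. *)
Lemma ln_strictly_concave (R : realType) (a b s : R) :
  0 < a -> 0 < b -> 0 < s < 1 ->
  s * ln a + (1 - s) * ln b <= ln (s * a + (1 - s) * b) ?= iff (a == b).
Proof.
move=> a0 b0 /andP[s0 s1]; set m := s * a + (1 - s) * b.
have s1' : 0 < 1 - s by rewrite subr_gt0.
have m0 : 0 < m by rewrite addr_gt0 ?mulr_gt0.
have [lea eqa] := ln_tangent_leif a0 m0.
have [leb eqb] := ln_tangent_leif b0 m0.
have mE : s * (a / m - 1) + (1 - s) * (b / m - 1) = 0.
  by rewrite /m; field; rewrite gt_eqF.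
split; first by nra.
apply/eqP/eqP => [ab|ab]; last by rewrite (_ : m = a) /m -ab; ring.
have /eqP : ln a - ln m = a / m - 1 by nra.
have /eqP : ln b - ln m = b / m - 1 by nra.
by rewrite eqa eqb => /eqP-> /eqP->.
Qed.

Lemma mx_conv_entry (F : comPzRingType) m p (c c' : F)
  (A B : 'M[F]_(m, p)) a b :
  (c *: A + c' *: B) a b = c * A a b + c' * B a b.
Proof. by rewrite !mxE. Qed.

(** * Moment matrices and their Hermitian forms *)

Section moments.
Context (R : realType) (n d : nat).
Local Notation angles := (d.-tuple (measurableTypeR R)).
Local Notation N := (n.+1 ^ d)%N.
Implicit Types (A B L : 'M[R[i]]_N) (Phi : 'rV[R[i]^o]_d -> R) (t : angles).

Definition quad L t : R[i] := ((K n (expi t)) ^t* *m L *m K n (expi t)) 0 0.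

Lemma quadE L t : quad L t =
  \sum_a \sum_b L b a * (K n (expi t) a 0 * Num.conj (K n (expi t) b 0)).
Proof.
rewrite /quad mxE; apply: eq_bigr => a _; rewrite mxE mulr_suml.
by apply: eq_bigr => b _; rewrite !mxE; ring.
Qed.

Lemma quad_conv A B (s : R) t : quad (s%:C *: A + (1 - s)%:C *: B) t =
  s%:C * quad A t + (1 - s)%:C * quad B t.
Proof.
rewrite !quadE !mulr_sumr -big_split; apply: eq_bigr => a _.
rewrite !mulr_sumr -big_split; apply: eq_bigr => b _ /=.
by rewrite !mxE; ring.
Qed.

Lemma quadB A B t : quad (A - B) t = quad A t - quad B t.
Proof. by rewrite /quad mulmxBr mulmxBl !mxE. Qed.

Lemma ccontinuous_quad L : ccontinuous (quad L).
Proof.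
rewrite (funext (quadE L)).
apply: ccontinuous_sum => a; apply: ccontinuous_sum => b.
apply: ccontinuousM; first exact: ccontinuous_cst.
by apply: ccontinuousM; [|apply: ccontinuousJ]; exact: ccontinuous_K.
Qed.

Lemma posdef_quad_gt0 L t : posdef L -> 0 < quad L t.
Proof. by case=> _; apply; exact: K_neq0. Qed.

Lemma GammaE Phi a b : Gamma n Phi a b = cintegral (fun t : angles =>
  (Phi (expi t))%:C * (K n (expi t) a 0 * Num.conj (K n (expi t) b 0))).
Proof.
rewrite mxE; congr cintegral; apply/funext => t.
by rewrite mul_mx_scalar -scalemxAl mxE mxE big_ord1 !mxE.
Qed.

Lemma ccontinuous_Gamma_entry Phi a b : C0plus Phi ->
  ccontinuous (fun t : angles =>
    (Phi (expi t))%:C * (K n (expi t) a 0 * Num.conj (K n (expi t) b 0))).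
Proof.
move=> [cPhi _]; apply: ccontinuousM.
  by apply: ccontinuous_real; exact: acontinuous_torus.
by apply: ccontinuousM; [|apply: ccontinuousJ]; exact: ccontinuous_K.
Qed.

(** [Gamma] is adjoint to the map from [L] to the trigonometric polynomial
    [quad L], for the trace pairing of matrices. *)
Lemma mxtrace_mul_Gamma L Phi : C0plus Phi ->
  \tr (L *m Gamma n Phi) = cintegral (fun t => (Phi (expi t))%:C * quad L t).
Proof.
move=> CPhi.
transitivity (cintegral (fun t : angles => \sum_b \sum_a L b a *
  ((Phi (expi t))%:C * (K n (expi t) a 0 * Num.conj (K n (expi t) b 0))))).
  have cF b a := ccontinuousM (@ccontinuous_cst R d (L b a))
    (ccontinuous_Gamma_entry a b CPhi).
  rewrite cintegral_sum => [|b]; last exact: ccontinuous_sum.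
  apply: eq_bigr => b _; rewrite cintegral_sum // mxE.
  apply: eq_bigr => a _; rewrite cintegralZ ?GammaE //.
  exact: ccontinuous_Gamma_entry.
congr cintegral; apply/funext => t; rewrite quadE exchange_big mulr_sumr.
apply: eq_bigr => a _; rewrite mulr_sumr; apply: eq_bigr => b _.
by rewrite mulrCA.
Qed.

Lemma C0plus_conv Phi Psi (s : R) : C0plus Phi -> C0plus Psi -> 0 <= s <= 1 ->
  C0plus (fun z => s * Phi z + (1 - s) * Psi z).
Proof.
move=> [cPhi Phi0] [cPsi Psi0] /andP[s0 s1]; split => [x|z zT].
  apply: cvgD; apply: cvgM; try exact: cvg_cst; first exact: cPhi.
  exact: cPsi.
have := Phi0 z zT; have := Psi0 z zT; nra.
Qed.

Lemma Gamma_conv Phi Psi (s : R) : C0plus Phi -> C0plus Psi ->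
  Gamma n (fun z => s * Phi z + (1 - s) * Psi z) =
  s%:C *: Gamma n Phi + (1 - s)%:C *: Gamma n Psi.
Proof.
move=> CPhi CPsi; apply/matrixP => a b.
pose F (Xi : 'rV[R[i]^o]_d -> R) (t : angles) : R[i] :=
  (Xi (expi t))%:C * (K n (expi t) a 0 * Num.conj (K n (expi t) b 0)).
have cF Xi (CXi : C0plus Xi) : ccontinuous (F Xi) :=
  ccontinuous_Gamma_entry a b CXi.
have cZ c Xi (CXi : C0plus Xi) : ccontinuous (fun t => c * F Xi t).
  by apply: ccontinuousM; [exact: ccontinuous_cst|exact: cF].
have G Xi : Gamma n Xi a b = cintegral (F Xi) by exact: GammaE.
rewrite (G (fun z => _)) mx_conv_entry.
transitivity (cintegral (fun t => s%:C * F Phi t + (1 - s)%:C * F Psi t)).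
  by congr cintegral; apply/funext => t; rewrite /F rmorphD !rmorphM /=; ring.
rewrite (cintegralD (cZ _ _ CPhi) (cZ _ _ CPsi)).
rewrite (cintegralZ _ (cF _ CPhi)) (cintegralZ _ (cF _ CPsi)).
by congr (_ * _ + _ * _); exact/esym/G.
Qed.

Lemma posdef_conv A B (s : R) : posdef A -> posdef B -> 0 <= s <= 1 ->
  posdef (s%:C *: A + (1 - s)%:C *: B).
Proof.
move=> [hA pA] [hB pB] /andP[s0 s1]; split.
  apply/matrixP => a b; rewrite -{2}hA -{2}hB !mxE rmorphD !rmorphM /=.
  by congr (_ * _ + _ * _); apply/eqP; rewrite eq_complex /= oppr0 !eqxx.
move=> v v0; rewrite mulmxDr mulmxDl -!scalemxAr -!scalemxAl mxE.
rewrite [X in 0 < X + _]mxE [X in 0 < _ + X]mxE.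
have := pA v v0; have := pB v v0.
set x := (_ *m B *m _) 0 0; set y := (_ *m A *m _) 0 0 => x0 y0.
(* At [s = 0] only the second term is positive; otherwise the first one is. *)
have [->|s_neq0] := eqVneq s 0; first by rewrite subr0 mul0r add0r mul1r.
apply: ltr_wpDr; last by rewrite mulr_gt0 // ltcR lt_neqAle eq_sym s_neq0.
by rewrite mulr_ge0 ?(ltW x0) // lecR subr_ge0.
Qed.

Lemma Lplus_conv A B (s : R) :
  @Lplus R n d A -> @Lplus R n d B -> 0 <= s <= 1 ->
  @Lplus R n d (s%:C *: A + (1 - s)%:C *: B).
Proof.
move=> [[Phi CPhi <-] pA] [[Psi CPsi <-] pB] s01; split;
  last exact: posdef_conv.
exists (fun z => s * Phi z + (1 - s) * Psi z); first exact: C0plus_conv.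
exact: Gamma_conv.
Qed.

(** For Hermitian [D] the trace of the square is the squared Frobenius norm. *)
Lemma hermitian_mxtrace_sqr_eq0 m (D : 'M[R[i]]_m) : D ^t* = D ->
  \tr (D *m D) = 0 -> D = 0.
Proof.
move=> Dherm; rewrite /mxtrace => D0.
have DE b : (D *m D) b b = \sum_a `|D b a| ^+ 2.
  rewrite mxE; apply: eq_bigr => a _.
  by rewrite normCK -[in D a b]Dherm !mxE.
have DD_ge0 b : 0 <= (D *m D) b b.
  by rewrite DE sumr_ge0 // => a _; exact: exprn_ge0.
apply/matrixP => b a; rewrite mxE; apply/eqP.
rewrite -normr_eq0 -sqrf_eq0; apply/eqP.
have /(_ b isT) := psumr_eq0P (fun c _ => DD_ge0 c) D0.
rewrite DE => norm0; apply: (psumr_eq0P _ norm0) => // c _; exact: exprn_ge0.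
Qed.

(** The difference [D] of the two matrices is itself a difference of moment
    matrices, so pairing [D] with itself is an integral against [quad D]. *)
Lemma Lplus_eq A B : @Lplus R n d A -> @Lplus R n d B ->
  {ae dm d, forall t, Td d t -> quad A t = quad B t} -> A = B.
Proof.
move=> [[Phi CPhi PhiA] [hA _]] [[Psi CPsi PsiB] [hB _]] qAB.
have tr0 Xi X : C0plus Xi -> Gamma n Xi = X -> \tr ((A - B) *m X) = 0.
  move=> CXi <-; rewrite mxtrace_mul_Gamma //; apply: cintegral_ae0.
    apply: ccontinuousM; last exact: ccontinuous_quad.
    by apply: ccontinuous_real; apply: acontinuous_torus; case: CXi.
  by apply: filterS qAB => t qt /qt; rewrite quadB => ->; rewrite subrr mulr0.
apply/eqP; rewrite -subr_eq0; apply/eqP; apply: hermitian_mxtrace_sqr_eq0.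
  by rewrite linearB map_mxB /= hA hB.
by rewrite mulmxBr raddfB /= (tr0 _ _ CPhi PhiA) (tr0 _ _ CPsi PsiB) subrr.
Qed.

(** * Strict convexity *)

Lemma J_strictly_convex P T A B (s : R) : C0plus P ->
  @Lplus R n d A -> @Lplus R n d B -> A <> B -> 0 < s < 1 ->
  J P T (s%:C *: A + (1 - s)%:C *: B) < s * J P T A + (1 - s) * J P T B.
Proof.
move=> CP LA LB AB s01; have [cP P_gt0] := CP.
set M := _ + _; have LM : @Lplus R n d M.
  by apply: Lplus_conv => //; have /andP[/ltW -> /ltW ->] := s01.
have q_gt0 L t : @Lplus R n d L -> 0 < complex.Re (quad L t).
  by move=> [_ pL]; have := posdef_quad_gt0 t pL; rewrite ltcE => /andP[].
have qM t : complex.Re (quad M t) =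
    s * complex.Re (quad A t) + (1 - s) * complex.Re (quad B t).
  by rewrite quad_conv ReD (Re_realM _ (quad A t)) (Re_realM _ (quad B t)).
pose f L t := P (expi t) * ln (complex.Re (quad L t)).
have cf L : @Lplus R n d L -> acontinuous (f L).
  move=> LL; apply: acontinuousM; first exact: acontinuous_torus.
  apply: acontinuous_comp (ccontinuous_quad L).1 => t.
  by apply: continuous_ln; exact: q_gt0.
pose gap t := f M t - (s * f A t + (1 - s) * f B t).
have csf c L : @Lplus R n d L -> acontinuous (fun t => c * f L t).
  by move=> LL; apply: acontinuousM; [exact: acontinuous_cst|exact: cf].
have cmix : acontinuous (fun t => s * f A t + (1 - s) * f B t).
  by apply: acontinuousD; exact: csf.
have cgap : acontinuous gap.
  by apply: acontinuousD; [exact: cf|exact: acontinuousN].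
have gapE t : gap t = P (expi t) * (ln (complex.Re (quad M t)) -
    (s * ln (complex.Re (quad A t)) + (1 - s) * ln (complex.Re (quad B t)))).
  have factor (p x y z : R) : p * x - (s * (p * y) + (1 - s) * (p * z)) =
    p * (x - (s * y + (1 - s) * z)) by ring.
  exact: factor.
have chord t := ln_strictly_concave (q_gt0 A t LA) (q_gt0 B t LB) s01.
have P0 t : 0 < P (expi t) by apply: P_gt0; exact: torus_expi.
have gap_ge0 t : 0 <= gap t.
  by rewrite gapE qM mulr_ge0 ?(ltW (P0 t)) // subr_ge0; exact: (chord t).1.
pose I L := \int[dm d]_(t in Td d) f L t.
have gap_int : \int[dm d]_(t in Td d) gap t = I M - (s * I A + (1 - s) * I B).
  have mT := @measurable_Td R d.
  have int L (LL : @Lplus R n d L) := acontinuous_integrable (cf L LL).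
  have IZ c L (LL : @Lplus R n d L) :
    \int[dm d]_(t in Td d) (c * f L t) = c * I L := RintegralZl c mT (int L LL).
  rewrite RintegralB //; [|exact: int|exact: acontinuous_integrable].
  rewrite RintegralD //; [|exact/acontinuous_integrable/csf..].
  by congr (_ - (_ + _)); exact: IZ.
have gap_gt0 : 0 < \int[dm d]_(t in Td d) gap t.
  rewrite lt_neqAle eq_sym Rintegral_ge0 ?andbT //.
  apply/eqP => /(Rintegral_eq0_ae cgap (fun t _ => gap_ge0 t)) gap0.
  apply: AB; apply: (Lplus_eq LA LB); apply: filterS gap0 => t gap0 /gap0 /eqP.
  rewrite gapE qM mulf_eq0 gt_eqF //= subr_eq0 eq_sym (chord t).2 => /eqP qAB.
  have := posdef_quad_gt0 t LA.2; have := posdef_quad_gt0 t LB.2.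
  (* Positivity of a complex number includes the vanishing of its imaginary
     part, so equal real parts give equal values. *)
  rewrite !ltcE /= => /andP[/eqP iB _] /andP[/eqP iA _].
  by apply/eqP; rewrite eq_complex qAB iA iB !eqxx.
have trM : complex.Re (\tr (M *m T)) =
    s * complex.Re (\tr (A *m T)) + (1 - s) * complex.Re (\tr (B *m T)).
  rewrite mulmxDl -!scalemxAl mxtraceD !mxtraceZ ReD.
  by rewrite (Re_realM _ (\tr (A *m T))) (Re_realM _ (\tr (B *m T))).
have JE L : J P T L = - I L + complex.Re (\tr (L *m T)) by [].
rewrite (JE M) (JE A) (JE B) trM; move: gap_gt0; rewrite gap_int.
move: (I M) (I A) (I B) (complex.Re _) (complex.Re _) => iM iA iB rA rB.
by rewrite -[in X in _ -> X]subr_gt0; congr (0 < _); ring.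
Qed.

End moments.

Theorem mainTheorem6 (R : realType) (d n : nat) (hd : (0 < d)%N) (hn : (0 < n)%N)
  (P : 'rV[R[i]^o]_d -> R) (T : 'M[R[i]]_(n.+1 ^ d))
  (hP : C0plus P) (hT : Splus T) :
  strictly_convex_on (@Lplus R n d) (J P T).
Proof.
split=> [A B t LA LB t01|A B t LA LB AB t01]; first exact: Lplus_conv.
exact: J_strictly_convex.
Qed.
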